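(* For all integers $n,\ell\ge1$, $$(-1)^{\ell-1}\sum_{j=-\ell+1}^{\ell}(-1)^j\,\mathrm{pod}\big(n-j(2j+1)\big)\ge0,$$ with strict inequality if $n\ge(2\ell+1)\ell$.
   Context: $\mathrm{pod}(n)$ denotes the number of partitions of $n$ in which the odd parts are distinct (even parts are unrestricted), with $\mathrm{pod}(0)=1$ and $\mathrm{pod}(n)=0$ for $n<0$; its generating function is $\sum_{n\ge0}\mathrm{pod}(n)q^n=\prod_{m\ge0}\frac{1+q^{2m+1}}{1-q^{2m+2}}$. *)

(* Defs.v *)
From mathcomp Require Import all_boot all_order all_algebra.

Set Implicit Arguments.
Unset Strict Implicit.
Unset Printing Implicit Defensive.

(* A partition of [n] is a finite multiset of positive integers with sum [n].
   It is encoded by its multiplicities: [f i] is the number of parts equal to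
   [i.+1].  The bounds lose nothing, since both the parts and the
   multiplicities of a partition of [n] are at most [n]. *)
Definition is_partition (n : nat) (f : {ffun 'I_n -> 'I_n.+1}) : bool :=
  \sum_(i < n) f i * i.+1 == n.

Definition odd_parts_distinct (n : nat) (f : {ffun 'I_n -> 'I_n.+1}) : bool :=
  [forall i : 'I_n, odd i.+1 ==> (f i <= 1)].

Definition pod_nat (n : nat) : nat :=
  #|[set f : {ffun 'I_n -> 'I_n.+1} | is_partition f && odd_parts_distinct f]|.

Definition pod (z : int) : nat :=
  match z with
  | Posz n => pod_nat n
  | Negz _ => 0
  end.

Local Open Scope ring_scope.

(* The sum of [F j] over the integers [j] with [- l + 1 <= j <= l]. *)
Definition sum_window (l : nat) (F : int -> int) : int :=
  \sum_(i < l.*2) F (i%:Z - l%:Z + 1).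

(* Main.v *)
Require Import Defs.
From HB Require Import structures.
From mathcomp Require Import all_boot all_order all_algebra ring zify.
Import Order.TTheory GRing.Theory Num.Theory.
Local Open Scope ring_scope.
Set Implicit Arguments.
Unset Strict Implicit.

(** Let P be the generating series of pod.  Since the exponents j(2j+1), for j
    running over the integers, are the triangular numbers T_0, T_1, T_2, ...,
    Gauss's identity says that P times the sum of (-1)^j q^(j(2j+1)) is 1, and
    the theorem is about truncations of that sum.

    Take first the truncation that stops after T_0, ..., T_(2k-1), called
    [gauss_sum k].  Let P_s be the product of the first s factors
    (1 + q^(2m+1)) / (1 - q^(2m+2)) of P, and let D_k(x) be the sum of the
    P_s x^s over s < k, a truncated q-binomial series.  Truncation leaves a
    single boundary term in the q-difference equation of D_k
    ([binom_sum_dilate]).  That one relation gives by induction on k Shanks's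
    identity P_k gauss_sum(k) = D_k(- q^(2k+1)), and, applied again and again
    to go from the argument - q^(2m+1) to - q^(2m+3), it gives
      P_(k+i) gauss_sum(k) = D_k(- q^(2(k+i)+1)) + (-1)^(k-1) Z
    where Z collects the boundary terms and is built from q and the series
    1 / (1 - q^m) by sums and products only, so that its coefficients are
    nonnegative.  For large i the first summand is 1 up to any prescribed
    order.  Hence (-1)^(k-1) P gauss_sum(k) is (-1)^(k-1) plus a nonnegative
    series.

    The window - l < j <= l consists of T_0, ..., T_(2l-2) and T_(2l): compared
    with [gauss_sum l] it has T_(2l) in place of T_(2l-1).  As these numbers
    differ by 2l, the signed product gains
      q^(l(2l-1)) (1 - q^(2l)) P,
    where (1 - q^(2l)) P counts the partitions without part 2l; it is
    nonnegative again, and for l >= 2 it dominates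
    (1 + q) / (1 - q^2) = 1 / (1 - q), all of whose coefficients are 1.  This
    gives positivity from n = l(2l-1) on.  For l = 1 the removed part 2 is
    needed for this bound, and P (1 - q^3) is compared with 1 / (1 - q) instead.

    Power series are handled modulo q^(N+1), as elements of a quotient of the
    polynomial ring over the integers.  The identities hold in any commutative
    ring in which the elements 1 - q^m with m > 0 have inverses. *)

(** * The truncated Gauss identity *)

Section Algebra.
Variables (R : comNzRingType) (q : R) (u : nat -> R).
Hypothesis mul_u : forall m, (0 < m)%N -> (1 - q ^+ m) * u m = 1.

Definition pod_factor m := (1 + q ^+ m.*2.+1) * u m.*2.+2.
Definition pod_prod s := \prod_(m < s) pod_factor m.
Definition binom_sum k x := \sum_(s < k) pod_prod s * x ^+ s.

Lemma pod_prodS s : pod_prod s.+1 = pod_factor s * pod_prod s.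
Proof. by rewrite /pod_prod big_ord_recr mulrC. Qed.

(** Cleared of denominators, the first-order recursion of the coefficients of
    [binom_sum]; it is what makes the q-difference equation telescope. *)
Lemma pod_prod_rec s :
  (1 - q ^+ s.*2.+2) * pod_prod s.+1 = (1 + q ^+ s.*2.+1) * pod_prod s.
Proof.
rewrite pod_prodS /pod_factor; have := @mul_u s.*2.+2 isT.
move: (u _) => v hv.
transitivity ((1 - q ^+ s.*2.+2) * v * ((1 + q ^+ s.*2.+1) * pod_prod s)).
  by ring.
by rewrite hv mul1r.
Qed.

(** The full q-binomial series satisfies (1 - x) D(x) = (1 + q x) D(q^2 x); the
    coefficient of x^s on both sides is [pod_prod_rec].  Cutting the series at
    k leaves only the term in x^k. *)
Lemma binom_sum_dilate k x :
  (1 - x) * binom_sum k x - (1 + q * x) * binom_sum k (q ^+ 2 * x)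
   = - ((1 - q ^+ k.*2) * pod_prod k * x ^+ k).
Proof.
elim: k => [|k IHk]; first by rewrite /binom_sum !big_ord0 double0 !expr0; ring.
rewrite /binom_sum !big_ord_recr /= -/(binom_sum k x).
rewrite -/(binom_sum k (q ^+ 2 * x)) doubleS pod_prod_rec.
have -> : (q ^+ 2 * x) ^+ k = q ^+ k.*2 * x ^+ k by rewrite exprMn -exprM mul2n.
rewrite [q ^+ _.*2.+1]exprS [x ^+ k.+1]exprS.
transitivity ((1 - x) * binom_sum k x - (1 + q * x) * binom_sum k (q ^+ 2 * x)
  + pod_prod k * x ^+ k * (1 - x - (1 + q * x) * q ^+ k.*2)); first by ring.
by rewrite IHk; ring.
Qed.

(** At x = - q^(2N+1) the factor 1 + q x becomes 1 - q^(2N+2), hence is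
    invertible, and 1 - x becomes 1 + q^(2N+1): the quotient of the two is the
    next factor of the product. *)
Lemma binom_sum_step k N :
  binom_sum k (- q ^+ N.*2.+3) = pod_factor N * binom_sum k (- q ^+ N.*2.+1)
   + (-1) ^+ k * (1 - q ^+ k.*2) * pod_prod k
     * (u N.*2.+2 * q ^+ (k * N.*2.+1)).
Proof.
have := binom_sum_dilate k (- q ^+ N.*2.+1).
have -> : q ^+ 2 * - q ^+ N.*2.+1 = - q ^+ N.*2.+3 by rewrite mulrN -exprD.
have -> : q * - q ^+ N.*2.+1 = - q ^+ N.*2.+2 by rewrite mulrN -exprS.
have -> : (- q ^+ N.*2.+1) ^+ k = (-1) ^+ k * q ^+ (k * N.*2.+1).
  by rewrite [LHS]exprNn -exprM mulnC.
rewrite /pod_factor.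
have := @mul_u N.*2.+2 isT; move: (u _) => v hv.
move: (binom_sum _ _) (binom_sum _ _) => e' e he.
have -> : e' = (1 - q ^+ N.*2.+2) * v * e' by rewrite hv mul1r.
transitivity (v * ((1 - - q ^+ N.*2.+1) * e -
   ((1 - - q ^+ N.*2.+1) * e - (1 + - q ^+ N.*2.+2) * e'))); first by ring.
by rewrite he; ring.
Qed.

(** Index j contributes the exponents of the integers j and - (j + 1), whose
    difference is 2j + 1. *)
Definition gauss_sum k :=
  \sum_(j < k) (-1) ^+ j * q ^+ (j * j.*2.+1) * (1 - q ^+ j.*2.+1).

(** Shanks's finite form of Gauss's identity, with q replaced by - q. *)
Lemma pod_prod_gauss_sum k :
  pod_prod k * gauss_sum k = binom_sum k (- q ^+ k.*2.+1).
Proof.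
elim: k => [|k IHk]; first by rewrite /gauss_sum /binom_sum !big_ord0 mulr0.
rewrite doubleS {1}/binom_sum big_ord_recr /= -/(binom_sum _ _).
rewrite binom_sum_step -IHk pod_prodS /gauss_sum big_ord_recr /=.
rewrite -/(gauss_sum k).
have -> : (- q ^+ k.*2.+3) ^+ k = (-1) ^+ k * (q ^+ (k * k.*2.+1) * q ^+ k.*2).
  by rewrite [LHS]exprNn -exprM -exprD; congr (_ * _ ^+ _); lia.
have := @mul_u k.*2.+2 isT; rewrite /pod_factor !exprS.
move: (u _) (q ^+ (k * _)) (q ^+ k.*2) (pod_prod k) (gauss_sum k) ((-1) ^+ k)
  => v Q A c f e hv.
transitivity ((1 + q * A) * v * (c * f) + e * (1 - A) * c * (v * Q)
   + (1 - q * (q * A)) * v * (c * e * Q * A)); first by ring.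
by rewrite hv; ring.
Qed.

(** The boundary terms accumulated by i uses of [binom_sum_step], without their
    common factor; every operation in it preserves nonnegativity. *)
Fixpoint tail_sum k i :=
  if i is i'.+1 then
    pod_factor (k + i') * tail_sum k i'
    + u (k + i').*2.+2 * q ^+ (k * (k + i').*2.+1)
  else 0.

Lemma truncated_gauss k i :
  pod_prod (k + i) * gauss_sum k = binom_sum k (- q ^+ (k + i).*2.+1)
    - (-1) ^+ k * (1 - q ^+ k.*2) * pod_prod k * tail_sum k i.
Proof.
elim: i => [|i IHi]; first by rewrite addn0 pod_prod_gauss_sum mulr0 subr0.
rewrite addnS pod_prodS doubleS binom_sum_step -mulrA IHi /=; ring.
Qed.

(** Passing from the window - j < i <= j to the next one adds the integers - j
    and j + 1.  For j = 0 the truncated predecessor is harmless, as it is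
    multiplied by 0. *)
Definition window_sum l :=
  \sum_(j < l) (-1) ^+ j * (q ^+ (j * j.*2.-1) - q ^+ (j.+1 * j.*2.+3)).

(** The window has the exponent l(2l+1) where [gauss_sum] has l(2l-1). *)
Lemma window_gauss l :
  window_sum l = gauss_sum l
    - (-1) ^+ l * q ^+ (l * l.*2.-1) * (1 - q ^+ l.*2).
Proof.
elim: l => [|l IHl].
  by rewrite /window_sum /gauss_sum !big_ord0 expr0; ring.
rewrite /window_sum /gauss_sum !big_ord_recr /= -/(window_sum l).
rewrite -/(gauss_sum l) IHl.
have -> : q ^+ (l * l.*2.+1) = q ^+ (l * l.*2.-1) * q ^+ l.*2.
  by rewrite -exprD; congr (_ ^+ _); case: l {IHl} => // l; rewrite /=; lia.
have -> : q ^+ (l.+1 * l.*2.+3) =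
    q ^+ (l * l.*2.-1) * q ^+ l.*2 * q ^+ l.*2.+1 * q ^+ l.*2.+2.
  by rewrite -!exprD; congr (_ ^+ _); case: l {IHl} => // l; rewrite /=; lia.
have -> : q ^+ (l.+1 * l.*2.+1) =
    q ^+ (l * l.*2.-1) * q ^+ l.*2 * q ^+ l.*2.+1.
  by rewrite -!exprD; congr (_ ^+ _); case: l {IHl} => // l; rewrite /=; lia.
rewrite doubleS !exprS; ring.
Qed.

(** The factor 1 - q^(2k+2) in front of the tail is the only one with a negative
    coefficient, and it cancels against the last denominator in the product. *)
Lemma signed_gauss k i :
  (-1) ^+ k * (pod_prod (k.+1 + i) * gauss_sum k.+1) =
    (-1) ^+ k * binom_sum k.+1 (- q ^+ (k.+1 + i).*2.+1)
    + (1 + q ^+ k.*2.+1) * pod_prod k * tail_sum k.+1 i.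
Proof.
rewrite truncated_gauss doubleS -pod_prod_rec [(-1) ^+ k.+1]exprS.
have : (-1) ^+ k * (-1) ^+ k = 1 :> R by rewrite -exprMn mulrNN mulr1 expr1n.
move: (tail_sum _ _) (pod_prod _) ((-1) ^+ k) (binom_sum _ _) => Z c e D he.
transitivity (e * D + (e * e) * ((1 - q ^+ k.*2.+2) * c * Z)); first by ring.
by rewrite he mul1r.
Qed.

Lemma signed_window k L :
  (-1) ^+ k * (pod_prod L * window_sum k.+1) =
    (-1) ^+ k * (pod_prod L * gauss_sum k.+1)
    + q ^+ (k.+1 * k.+1.*2.-1) * ((1 - q ^+ k.+1.*2) * pod_prod L).
Proof.
rewrite window_gauss [(-1) ^+ k.+1]exprS.
have : (-1) ^+ k * (-1) ^+ k = 1 :> R by rewrite -exprMn mulrNN mulr1 expr1n.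
move: (gauss_sum _) (pod_prod _) ((-1) ^+ k) (q ^+ _) (q ^+ _)
  => G c e B A he.
transitivity (e * (c * G) + (e * e) * (A * ((1 - B) * c))); first by ring.
by rewrite he mul1r.
Qed.

(** * Factors that dominate the geometric series *)

Lemma u1_u2 : u 1 = (1 + q) * u 2.
Proof.
transitivity ((1 - q ^+ 2) * u 2 * u 1); first by rewrite mul_u // mul1r.
transitivity ((1 - q ^+ 1) * u 1 * ((1 + q) * u 2)); first by ring.
by rewrite mul_u // mul1r.
Qed.

Lemma u2_u4 : u 2 = (1 + q ^+ 2) * u 4.
Proof.
transitivity ((1 - q ^+ 4) * u 4 * u 2); first by rewrite mul_u // mul1r.
transitivity ((1 - q ^+ 2) * u 2 * ((1 + q ^+ 2) * u 4)); first by ring.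
by rewrite mul_u // mul1r.
Qed.

Lemma u1_shift : u 1 = 1 + q * u 1.
Proof. by rewrite -[1 in RHS](@mul_u 1 isT); ring. Qed.

(** Multiplying by 1 - q^(2k+4) removes the part 2k+4, and the factor of index 0
    is 1 / (1 - q). *)
Lemma pod_prod_no_part k L (h0 : (0 < L)%N) (hk : (k.+1 < L)%N) :
  (1 - q ^+ k.+2.*2) * pod_prod L =
    u 1 * ((1 + q ^+ k.+1.*2.+1) *
      \prod_(j < L | (j != Ordinal hk) && (j != Ordinal h0)) pod_factor j).
Proof.
rewrite /pod_prod (bigD1 (Ordinal hk)) //= (bigD1 (Ordinal h0)) //=.
move: (\prod_(_ < _ | _) _) => rest.
rewrite u1_u2 /pod_factor double0 expr1 -doubleS.
have := @mul_u k.+2.*2 isT; move: (q ^+ k.+2.*2) (u k.+2.*2) => Q v hv.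
transitivity (((1 - Q) * v) *
   ((1 + q) * u 2 * ((1 + q ^+ k.+1.*2.+1) * rest))); first by ring.
by rewrite hv mul1r.
Qed.

(** For l = 1 the factor 1 - q^3 combines with the first two factors into
    (1 + q)(1 + q^2 + q^4) / (1 - q^4), of which
    (1 + q)(1 + q^2) / (1 - q^4) = 1 / (1 - q) is a part. *)
Lemma window_sum1 L (h0 : (0 < L)%N) (h1 : (1 < L)%N) :
  pod_prod L * window_sum 1 =
    (u 1 + (1 + q) * u 4 * q ^+ 4) *
      \prod_(j < L | (j != Ordinal h0) && (j != Ordinal h1)) pod_factor j.
Proof.
rewrite /window_sum big_ord1 /pod_prod (bigD1 (Ordinal h0)) //=.
rewrite (bigD1 (Ordinal h1)) //=; move: (\prod_(_ < _ | _) _) => rest.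
rewrite u1_u2 u2_u4 /pod_factor /= double0.
transitivity ((1 - q ^+ 2) * u 2 *
  ((1 + q) * (1 + q ^+ 2 + q ^+ 4) * u 4 * rest)); first by ring.
by rewrite mul_u // mul1r; ring.
Qed.
End Algebra.

(** * Integer power series modulo q^(N+1) *)

(** The modulus is hidden behind a name so that rewriting with laws of powers
    does not affect the type. *)
Definition tser N := {poly %/ ('X^(N.+1) : {poly int})}.

HB.instance Definition _ N := GRing.ComNzRing.on (tser N).

Definition trunc N (p : {poly int}) : tser N := in_qpoly _ p.

HB.instance Definition _ N :=
  GRing.RMorphism.copy (trunc N) (in_qpoly ('X^(N.+1) : {poly int})).

Definition coeft N (x : tser N) i : int := (x : {poly int})`_i.

Section TruncatedSeries.
Variable N : nat.
Implicit Types (x y : tser N) (p : {poly int}).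

Lemma coeft_trunc p i : (i <= N)%N -> coeft (trunc N p) i = p`_i.
Proof.
move=> hi; rewrite /coeft /= mk_monic_Xn /=.
rewrite [in RHS](Pdiv.RingMonic.rdivp_eq (monicXn _ N.+1) p).
by rewrite coefD coefMXn ltnS hi add0r.
Qed.

Lemma coeft_large x i : (N < i)%N -> coeft x i = 0.
Proof.
move=> hi; rewrite /coeft nth_default // -ltnS.
apply: leq_trans (size_mk_monic x) _; rewrite mk_monic_Xn size_polyXn.
exact: hi.
Qed.

Lemma coeftP x y : (forall i, (i <= N)%N -> coeft x i = coeft y i) -> x = y.
Proof.
move=> h; apply/val_inj/polyP => i; rewrite -!/(coeft _ i).
by case: (leqP i N) => [/h|hi] //; rewrite !coeft_large.
Qed.

Lemma coeftM x y i : (i <= N)%N ->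
  coeft (x * y) i = \sum_(j < i.+1) coeft x j * coeft y (i - j).
Proof. by move=> hi; rewrite -[x * y]/(trunc _ _) coeft_trunc // coefM. Qed.

Lemma coeft0 i : coeft (0 : tser N) i = 0.
Proof. exact: coef0. Qed.

Lemma coeft1 i : coeft (1 : tser N) i = (i == 0)%:R.
Proof. exact: coef1. Qed.

Lemma coeftD x y i : coeft (x + y) i = coeft x i + coeft y i.
Proof. exact: coefD. Qed.

Lemma coeftN x i : coeft (- x) i = - coeft x i.
Proof. exact: coefN. Qed.

Lemma coeft_signM k x i : coeft ((-1) ^+ k * x) i = (-1) ^+ k * coeft x i.
Proof.
rewrite -signr_odd -[in RHS]signr_odd.
by case: odd; rewrite ?expr1 ?expr0 ?mul1r // !mulN1r coeftN.
Qed.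

Definition qvar : tser N := trunc N 'X.

Lemma qvarX m : qvar ^+ m = trunc N 'X^m.
Proof. by rewrite rmorphXn. Qed.

Lemma coeft_qvarM m x i : (i <= N)%N ->
  coeft (qvar ^+ m * x) i = if (i < m)%N then 0 else coeft x (i - m).
Proof.
move=> hi; have -> : x = trunc N (x : {poly int}).
  by apply: coeftP => j hj; rewrite coeft_trunc.
rewrite qvarX -rmorphM /= coeft_trunc // coefXnM.
by case: ifP => // _; rewrite coeft_trunc //; lia.
Qed.

Lemma coeft_qvarX m i : (i <= N)%N -> coeft (qvar ^+ m) i = (i == m)%:R.
Proof. by move=> hi; rewrite qvarX coeft_trunc // coefXn. Qed.

Lemma qvarX_eq0 m : (N < m)%N -> qvar ^+ m = 0.
Proof.
move=> hm; apply: coeftP => i hi; rewrite coeft_qvarX // coeft0.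
by case: eqP => // e; lia.
Qed.

Definition geom m : tser N := \sum_(a < N.+1) qvar ^+ (m * a).

Lemma mul_geom m : (0 < m)%N -> (1 - qvar ^+ m) * geom m = 1.
Proof.
move=> hm; have h : (qvar ^+ m) ^+ N.+1 = 0 by rewrite -exprM qvarX_eq0 //; nia.
have := subrX1 (qvar ^+ m) N.+1; rewrite h sub0r => e.
rewrite -[RHS]opprK e -mulNr opprB; congr (_ * _).
by apply: eq_bigr => a _; rewrite exprM.
Qed.

Lemma coeft_geom1 i : (i <= N)%N -> coeft (geom 1) i = 1.
Proof.
elim: i => [|i IHi] hi; rewrite (u1_shift mul_geom) coeftD coeft1 /=.
  by rewrite -[X in X * _]expr1 coeft_qvarM // addr0.
by rewrite -[X in X * _]expr1 coeft_qvarM // add0r subn1 IHi // ltnW.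
Qed.

(** * Nonnegative truncated series *)

Definition nneg x := forall i, 0 <= coeft x i.

Lemma nneg0 : nneg 0.
Proof. by move=> i; rewrite coeft0. Qed.

Lemma nneg1 : nneg 1.
Proof. by move=> i; rewrite coeft1 ler0n. Qed.

Lemma nnegD x y : nneg x -> nneg y -> nneg (x + y).
Proof. by move=> hx hy i; rewrite coeftD addr_ge0. Qed.

Lemma nnegM x y : nneg x -> nneg y -> nneg (x * y).
Proof.
move=> hx hy i; case: (leqP i N) => hi; last by rewrite coeft_large.
by rewrite coeftM // sumr_ge0 // => j _; rewrite mulr_ge0.
Qed.

Lemma nneg_qvarX m : nneg (qvar ^+ m).
Proof.
move=> i; case: (leqP i N) => hi; last by rewrite coeft_large.
by rewrite coeft_qvarX // ler0n.
Qed.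

(** A factor that dominates 1 coefficientwise may be dropped from a lower bound;
    see [nneg_mul_ge1]. *)
Definition ge1 x := nneg (x - 1).

Lemma ge1_nneg x : ge1 x -> nneg x.
Proof.
by move=> h; rewrite -[x](subrK 1); apply: nnegD => //; apply: nneg1.
Qed.

Lemma ge1_1D x : nneg x -> ge1 (1 + x).
Proof. by move=> hx; rewrite /ge1 addrC addKr. Qed.

Lemma nneg_mul_ge1 x y : nneg x -> ge1 y -> nneg (x * y - x).
Proof. by move=> hx hy; rewrite -[X in _ - X]mulr1 -mulrBr; apply: nnegM. Qed.

Lemma ge1M x y : ge1 x -> ge1 y -> ge1 (x * y).
Proof.
move=> hx hy; rewrite /ge1 -[x * y](subrK x) -addrA; apply: nnegD => //.
exact: nneg_mul_ge1 (ge1_nneg hx) hy.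
Qed.

Lemma ge1_geom m : ge1 (geom m).
Proof.
rewrite /geom big_ord_recl muln0 expr0; apply: ge1_1D.
apply: (big_ind nneg) => [||a _]; [exact: nneg0 | exact: nnegD |].
exact: nneg_qvarX.
Qed.

Lemma ge1_pod_factor m : ge1 (pod_factor qvar geom m).
Proof. by apply: ge1M (ge1_geom _); apply/ge1_1D/nneg_qvarX. Qed.

Lemma ge1_prod_factors L (P : pred 'I_L) :
  ge1 (\prod_(i < L | P i) pod_factor qvar geom i).
Proof.
apply: (big_ind ge1) => [||i _]; [|exact: ge1M|exact: ge1_pod_factor].
by rewrite /ge1 subrr; apply: nneg0.
Qed.

Lemma nneg_tail_sum k i : nneg (tail_sum qvar geom k i).
Proof.
elim: i => [|i IHi] /=; first exact: nneg0.
apply: nnegD; apply: nnegM => //; try exact: nneg_qvarX.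
  exact/ge1_nneg/ge1_pod_factor.
exact/ge1_nneg/ge1_geom.
Qed.

(** At a high power of q only the constant term of the sum survives. *)
Lemma binom_sum_top k m : (N < m)%N ->
  binom_sum qvar geom k.+1 (- qvar ^+ m) = 1.
Proof.
move=> hm; rewrite qvarX_eq0 // oppr0 /binom_sum big_ord_recl expr0 mulr1.
rewrite /pod_prod big_ord0 big1 ?addr0 // => i _.
by rewrite expr0n mulr0.
Qed.

Lemma gauss_nneg k L : (N + k < L)%N ->
  nneg ((-1) ^+ k * (pod_prod qvar geom L * gauss_sum qvar k.+1) - (-1) ^+ k).
Proof.
move=> hL; have -> : L = (k.+1 + (L - k.+1))%N by lia.
rewrite (signed_gauss mul_geom) binom_sum_top; last by lia.
rewrite mulr1 addrC addKr; apply: nnegM (nneg_tail_sum _ _); apply: nnegM.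
  exact/ge1_nneg/ge1_1D/nneg_qvarX.
exact/ge1_nneg/ge1_prod_factors.
Qed.

Lemma pod_prod_no_part_nneg k L : (k.+1 < L)%N ->
  nneg ((1 - qvar ^+ k.+2.*2) * pod_prod qvar geom L - geom 1).
Proof.
move=> hk; have h0 : (0 < L)%N by lia.
rewrite (pod_prod_no_part mul_geom h0 hk).
apply: nneg_mul_ge1 (ge1_nneg (ge1_geom _)) _.
by apply: ge1M (ge1_prod_factors _); apply/ge1_1D/nneg_qvarX.
Qed.

Lemma window_sum1_nneg L : (1 < L)%N ->
  nneg (pod_prod qvar geom L * window_sum qvar 1 - geom 1).
Proof.
move=> h1; have h0 : (0 < L)%N by lia.
rewrite (window_sum1 mul_geom h0 h1).
set y := (1 + qvar) * geom 4 * qvar ^+ 4; set rest := \prod_(_ < _ | _) _.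
have hy : nneg y.
  apply: nnegM (nneg_qvarX _); apply: nnegM (ge1_nneg (ge1_geom _)).
  by apply/ge1_nneg/ge1_1D; rewrite -[qvar]expr1; apply: nneg_qvarX.
have hg := ge1_nneg (ge1_geom 1).
have -> : (geom 1 + y) * rest - geom 1 =
    ((geom 1 + y) * rest - (geom 1 + y)) + y by move: (geom 1) => g; ring.
apply: nnegD => //; apply: nneg_mul_ge1; first exact: nnegD.
exact: ge1_prod_factors.
Qed.

(** The last term gives strict positivity: it contributes 1 to each exponent
    that is at least (k+1)(2k+1). *)
Lemma window_nneg k L : (N + k + 1 < L)%N ->
  nneg ((-1) ^+ k * (pod_prod qvar geom L * window_sum qvar k.+1)
        - (-1) ^+ k - qvar ^+ (k.+1 * k.+1.*2.-1) * geom 1).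
Proof.
case: k => [|k] hL.
  (* For l = 1 the subtracted terms 1 and q / (1 - q) add up to 1 / (1 - q). *)
  rewrite !expr0 mul1r expr1 -addrA -opprD -(u1_shift mul_geom).
  by apply: window_sum1_nneg; lia.
rewrite (signed_window _ geom) -addrA addrACA -mulrBr; apply: nnegD.
  by apply: gauss_nneg; lia.
apply: nnegM; first exact: nneg_qvarX.
by apply: pod_prod_no_part_nneg; lia.
Qed.
End TruncatedSeries.

(** * The product as generating function *)

(** The bound B on the multiplicities is kept apart from the order of truncation
    because [pod_nat n] bounds the multiplicities by n itself. *)
Definition part_poly B i : {poly int} :=
  \sum_(0 <= a < B.+1 | odd i.+1 ==> (a <= 1)%N) 'X^(a * i.+1).

(** Expanding the product of sums yields one monomial for each function that
    selects the multiplicities. *)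
Lemma coef_part_polys M :
  (\prod_(0 <= i < M) part_poly M i)`_M = (pod_nat M)%:Z.
Proof.
rewrite big_mkord; under eq_bigr do rewrite /part_poly big_mkord.
rewrite bigA_distr_big_dep /= coef_sum /pod_nat -sum1_card -natz natr_sum.
rewrite big_mkcond [RHS]big_mkcond /=; apply: eq_bigr => f _.
rewrite -expr_sum coefXn [in RHS]inE /is_partition /odd_parts_distinct eq_sym.
rewrite andbC.
rewrite (_ : (f \in family _)
  = [forall i : 'I_M, odd i.+1 ==> (f i <= 1)%N]) //.
by case: ifP => _; case: eqP.
Qed.

Lemma trunc_part_poly M B i : (M <= B)%N ->
  trunc M (part_poly B i) = trunc M (part_poly M i).
Proof.
move=> hB; rewrite /part_poly (@big_cat_nat _ _ _ M.+1) //= rmorphD /=.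
rewrite [X in _ + X](_ : _ = 0) ?addr0 // rmorph_sum big_nat_cond big1 //=.
by move=> a /andP[/andP[h _] _]; rewrite -qvarX qvarX_eq0 //; nia.
Qed.

Lemma trunc_part_poly1 M i : (M <= i)%N -> trunc M (part_poly M i) = 1.
Proof.
move=> hi; rewrite /part_poly big_mkcond big_nat_recl //= implybT mul0n expr0.
rewrite rmorphD rmorph1 rmorph_sum big_nat_cond big1 ?addr0 //= => a _.
by case: ifP => _; rewrite ?rmorph0 // -qvarX qvarX_eq0 //; nia.
Qed.

(** Neither parts nor multiplicities greater than M matter up to q^M: this lets
    a single product encode all the values of pod with smaller argument. *)
Lemma trunc_part_polys M B t : (M <= B)%N -> (M <= t)%N ->
  trunc M (\prod_(0 <= i < t) part_poly B i)
   = trunc M (\prod_(0 <= i < M) part_poly M i).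
Proof.
move=> hB ht; rewrite !rmorph_prod (@big_cat_nat _ _ _ M) //=.
rewrite [X in _ * X](_ : _ = 1) ?mulr1.
  by apply: eq_bigr => i _; rewrite trunc_part_poly.
rewrite big_nat_cond big1 // => i /andP[/andP[h _] _].
by rewrite trunc_part_poly // trunc_part_poly1.
Qed.

(** The bound 0 < N leaves room for the multiplicity 1 of an odd part. *)
Lemma pod_prod_part_polys N s : (0 < N)%N ->
  pod_prod (qvar N) (@geom N) s
    = trunc N (\prod_(0 <= i < s.*2) part_poly N i).
Proof.
move=> hN; elim: s => [|s IHs].
  by rewrite big_nil rmorph1 /pod_prod big_ord0.
rewrite pod_prodS doubleS !big_nat_recr //= !rmorphM /= -IHs mulrC -mulrA.
rewrite /pod_factor; congr (_ * (_ * _)).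
  rewrite /part_poly big_mkcond /= odd_double; case: N hN {IHs} => // N _.
  rewrite !big_nat_recl //= mul0n mul1n big_nat_cond big1; last by case.
  by rewrite expr0 addr0 rmorphD rmorph1 qvarX.
rewrite /geom /part_poly big_mkord rmorph_sum /= odd_double /=.
by apply: eq_bigr => a _; rewrite qvarX mulnC.
Qed.

Lemma coeft_pod_prod N s j : (0 < N)%N -> (j <= N)%N -> (j <= s.*2)%N ->
  coeft (pod_prod (qvar N) (@geom N) s) j = (pod_nat j)%:Z.
Proof.
move=> hN hj hs; rewrite pod_prod_part_polys // coeft_trunc //.
rewrite -(@coeft_trunc j) // trunc_part_polys // coeft_trunc //.
exact: coef_part_polys.
Qed.

(** * The sum over the window *)

Lemma sum_windowS l F :
  sum_window l.+1 F = F (- l%:Z) + sum_window l F + F l.+1%:Z.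
Proof.
rewrite /sum_window doubleS big_ord_recl big_ord_recr /= addrA.
congr (_ + _ + _).
- by congr F; lia.
- by apply: eq_bigr => i _; congr F; rewrite /bump /=; lia.
- by congr F; rewrite /bump /=; lia.
Qed.

Lemma pod_sub n e :
  pod (n%:Z - e%:Z) = if (n < e)%N then 0%N else pod_nat (n - e).
Proof.
case: ltnP => h; last by rewrite subzn.
by have -> : n%:Z - e%:Z = Negz (e - n).-1 by lia.
Qed.

Lemma sum_window_pod n l L : (0 < n)%N -> (n <= L)%N ->
  sum_window l
    (fun j : int => (-1) ^ j * (pod (n%:Z - j * (2 * j + 1)))%:Z)
   = coeft (pod_prod (qvar n) (@geom n) L * window_sum (qvar n) l) n.
Proof.
move=> hn hL.
have hc e : coeft (pod_prod (qvar n) (@geom n) L * qvar n ^+ e) n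
    = (pod (n%:Z - e%:Z))%:Z.
  rewrite mulrC coeft_qvarM // pod_sub; case: ltnP => // he.
  by rewrite coeft_pod_prod //; lia.
elim: l => [|l IHl].
  by rewrite /sum_window /window_sum !big_ord0 mulr0 coeft0.
rewrite sum_windowS {}IHl.
have -> : window_sum (qvar n) l.+1 = window_sum (qvar n) l +
    (-1) ^+ l * (qvar n ^+ (l * l.*2.-1) - qvar n ^+ (l.+1 * l.*2.+3)).
  by rewrite /window_sum big_ord_recr.
rewrite [in RHS]mulrDr coeftD [in RHS]mulrCA coeft_signM.
rewrite [in RHS]mulrBr coeftD coeftN !hc.
rewrite !expN1r abszN !absz_nat exprS.
have -> : - l%:Z * (2 * - l%:Z + 1) = (l * l.*2.-1)%N by nia.
have -> : l.+1%:Z * (2 * l.+1%:Z + 1) = (l.+1 * l.*2.+3)%N by nia.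
ring.
Qed.

Unset Implicit Arguments.

Theorem corollary4p3 (n l : nat) (hn : (1 <= n)%N) (hl : (1 <= l)%N) :
  let S : int :=
    (-1) ^+ (l - 1) *
    sum_window l (fun j : int =>
      (-1) ^ j * (pod (n%:Z - j * (2 * j + 1)))%:Z) in
  0 <= S /\ (((2 * l + 1) * l <= n)%N -> 0 < S).
Proof.
move=> S; rewrite {}/S; case: l hl => // k _.
rewrite (@sum_window_pod n k.+1 (n + k + 2)) //; last by lia.
rewrite subn1 /= -coeft_signM.
have hL : (n + k + 1 < n + k + 2)%N by lia.
have hs : coeft ((-1) ^+ k : tser n) n = 0.
  by rewrite -[X in coeft X]mulr1 coeft_signM coeft1 eqn0Ngt hn mulr0.
have := window_nneg hL n; rewrite !coeftD !coeftN coeft_qvarM // hs subr0.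
case: ltnP => h; first by rewrite subr0 => h0; split=> // h'; exfalso; nia.
rewrite coeft_geom1; last by lia.
rewrite subr_ge0 => h1.
by split=> [|_]; [apply: le_trans h1 | apply: lt_le_trans h1].
Qed.
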